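(* Let $\phi = \frac{1+\sqrt{5}}{2}$ and let $M(n)$ denote the maximal length of a play of the ordered Zeckendorf game on $n$. Then, as $n \to \infty$, $$M(n) \le \frac{n^2}{2} - \frac{1}{32}\, n\log_\phi n + o(n\log_\phi n);$$ that is, there is a function $e(n)$ with $e(n)/(n\log_\phi n) \to 0$ as $n\to\infty$ such that $M(n) \le \frac{n^2}{2} - \frac{1}{32} n\log_\phi n + e(n)$ for all integers $n \ge 2$.
   Context: The Fibonacci numbers are indexed by $F_1 = 1$, $F_2 = 2$, and $F_{i+1} = F_i + F_{i-1}$ for $i \ge 2$. The (two-player) ordered Zeckendorf game on $n$: a state is a finite ordered list (tuple) of Fibonacci numbers. The initial state is the list $(F_1, F_1, \dots, F_1)$ of $n$ copies of $F_1$. Players alternate turns; on each turn the player performs one of the following legal moves on two adjacent entries of the list (the other entries and their order being unchanged): (1) Merging: replace an adjacent pair $(F_i, F_{i+1})$ with the single entry $F_{i+2}$. (2) Merging ones: replace an adjacent pair $(F_1, F_1)$ with the single entry $F_2$. (3) Splitting: replace an adjacent pair $(F_i, F_i)$ with $(F_{i-2}, F_{i+1})$, for $i > 2$. (4) Splitting twos: replace an adjacent pair $(F_2, F_2)$ with $(F_1, F_3)$. (5) Switching: replace an adjacent pair $(F_i, F_j)$ with $(F_j, F_i)$ whenever $i > j$. The game ends when no legal move can be applied. The length of a play is the total number of moves made (by both players together). *)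

(* Defs.v *)
From mathcomp Require Import all_boot all_order all_algebra.
From mathcomp Require Import all_classical all_reals all_analysis.
Import Order.TTheory GRing.Theory Num.Theory.

Set Implicit Arguments.
Unset Strict Implicit.
Unset Printing Implicit Defensive.

(* F_1 = 1 and F_2 = 2; the value at index 0, which is not a Fibonacci number
   of the game, only makes the recurrence give F_2. *)
Fixpoint zfib (n : nat) : nat :=
  match n with
  | 0 => 1
  | S m => match m with
           | 0 => 1
           | S k => zfib m + zfib k
           end
  end.

(* [zmove_local u v]: a legal move rewrites the adjacent entries [u] into [v].
   Every index is at least 1. *)
Inductive zmove_local : seq nat -> seq nat -> Prop :=
| ZMerge i of 0 < i :
    zmove_local [:: zfib i; zfib i.+1] [:: zfib i.+2]
| ZMergeOnes :
    zmove_local [:: zfib 1; zfib 1] [:: zfib 2]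
| ZSplit i of 2 < i :
    zmove_local [:: zfib i; zfib i] [:: zfib (i - 2); zfib i.+1]
| ZSplitTwos :
    zmove_local [:: zfib 2; zfib 2] [:: zfib 1; zfib 3]
| ZSwitch i j of 0 < j & j < i :
    zmove_local [:: zfib i; zfib j] [:: zfib j; zfib i].

Inductive zmove : seq nat -> seq nat -> Prop :=
| ZMove s1 s2 u v of zmove_local u v : zmove (s1 ++ u ++ s2) (s1 ++ v ++ s2).

Definition zterminal (s : seq nat) : Prop := forall t, ~ zmove s t.

(* [zplay s k]: from [s] the game can be played to its end in exactly [k]
   moves. *)
Inductive zplay : seq nat -> nat -> Prop :=
| ZEnd s of zterminal s : zplay s 0
| ZStep s t k of zmove s t & zplay t k : zplay s k.+1.

Definition zinit (n : nat) : seq nat := nseq n (zfib 1).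

Definition is_max_play_length (n m : nat) : Prop :=
  zplay (zinit n) m /\ forall k, zplay (zinit n) k -> k <= m.

Definition golden {R : realType} : R := ((1 + Num.sqrt 5) / 2)%R.

Definition log_golden {R : realType} (x : R) : R := (ln x / ln golden)%R.

(* Main.v *)
Require Import Defs.
From mathcomp Require Import all_boot all_order all_algebra.
From mathcomp Require Import all_classical all_reals all_analysis.
From mathcomp Require Import zify lra.
Import Order.TTheory GRing.Theory Num.Theory numFieldNormedType.Exports.
Local Open Scope classical_set_scope.

(** The proof is a single potential argument.  Weigh a state by its moment, the
    sum over its entries of (value) * (number of entries to its right).
    Every move lowers the moment by at least 1, and the initial moment is
    n (n - 1) / 2, which explains the leading term n ^ 2 / 2.

    The n log n saving comes from the fact that moves which create large
    Fibonacci numbers are wasteful: merging F_i, F_(i+1) lowers the moment by at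
    least F_i, and splitting F_i, F_i lowers it by F_i - F_(i-2) = F_(i-1).
    Measure how far the mass of a state has climbed by its height, the sum over
    its entries F_i of F_i * max(i - 3, 0).  A move that raises the height by h
    lowers the moment by at least 1 + h / 6 ([zmove_local_potential]); starting
    the levels after F_3 makes the moves among 1, 2 and 3, which may lower
    the moment by just 1, leave the height unchanged.  Hence the potential
    6 * moment + height drops by at least 6 at each move.

    At the end of a play the entries are strictly increasing, so the
    largest of them, F_m, is at least a third of their sum n
    ([height_sorted_fib]); the final height is then at least n (m - 3) / 3, where
    m + 2 >= log_phi n because F_(m+2) >= n.  So a play of length k satisfies
    18 k + n (m - 3) <= 9 n (n - 1) ([zplay_length]), that is
    k <= n ^ 2 / 2 - n log_phi n / 18 + O(n).  This beats the constant 1 / 32 and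
    lets the error term be e(n) = n.  Maximal lengths exist because the
    potential bounds every play and forces each state to have one. *)

(* Keeps simplification from unfolding [zfib i.+1] into a [match]. *)
Local Arguments zfib : simpl never.

(** * Fibonacci numbers *)

Lemma zfibSS i : zfib i.+2 = zfib i.+1 + zfib i.
Proof. by []. Qed.

Lemma zfib_gt0 i : 0 < zfib i.
Proof.
by elim/ltn_ind: i => -[|[|i]] IH //; rewrite zfibSS addn_gt0 IH.
Qed.

Lemma zfib_lt i j : 0 < i -> i < j -> zfib i < zfib j.
Proof.
have step k : 0 < k -> zfib k < zfib k.+1.
  by case: k => // k _; rewrite zfibSS -addn1 leq_add2l zfib_gt0.
move=> i_gt0; elim: j => // j IH; rewrite ltnS leq_eqVlt.
case/predU1P=> [<- | ltij]; first exact: step.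
exact: ltn_trans (IH ltij) (step _ (leq_trans i_gt0 (ltnW ltij))).
Qed.

Lemma zfib_le i j : 0 < i -> i <= j -> zfib i <= zfib j.
Proof.
move=> i_gt0; rewrite leq_eqVlt => /predU1P[-> // | ltij].
by rewrite ltnW // zfib_lt.
Qed.

Lemma zfib_leE i j : 0 < i -> 0 < j -> (zfib i <= zfib j) = (i <= j).
Proof.
move=> i_gt0 j_gt0; apply/idP/idP; last exact: zfib_le.
by apply: contraLR; rewrite -!ltnNge; apply: zfib_lt.
Qed.

Lemma leq_zfib i : i <= zfib i.
Proof.
elim: i => [//|[//|i] IH]; exact: leq_ltn_trans IH (zfib_lt _ _ _ _).
Qed.

(** * Moment, height and potential *)

(** States hold values, whereas heights need indices.  Counting the Fibonacci
    numbers from F_4 on that are at most [v] recovers the truncated index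
    i - 3 from v = F_i; the range may stop at index v + 3 since i <= F_i. *)
Definition level (v : nat) : nat := count (fun k => zfib k <= v) (iota 4 v).

Lemma level_zfib i : 0 < i -> level (zfib i) = i - 3.
Proof.
move=> i_gt0; rewrite /level.
have -> : iota 4 (zfib i) = iota 4 (i - 3) ++ iota (4 + (i - 3)) (zfib i - (i - 3)).
  by rewrite -iotaD subnKC // (leq_trans (leq_subr _ _)) // leq_zfib.
rewrite count_cat.
have /eq_in_count -> : {in iota 4 (i - 3), (fun k => zfib k <= zfib i) =1 predT}.
  by move=> k; rewrite mem_iota => kP; rewrite zfib_leE /=; lia.
have /eq_in_count -> : {in iota (4 + (i - 3)) (zfib i - (i - 3)),
    (fun k => zfib k <= zfib i) =1 pred0}.
  by move=> k; rewrite mem_iota => kP; rewrite zfib_leE //=; lia.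
by rewrite count_predT count_pred0 size_iota addn0.
Qed.

Fixpoint moment (s : seq nat) : nat :=
  if s is a :: s' then a * size s' + moment s' else 0.

Definition height (s : seq nat) : nat := sumn [seq x * level x | x <- s].

Definition potential (s : seq nat) : nat := 6 * moment s + height s.

(** Besides the moments of the two parts, only the mass of [s1] and the size of
    [s2] matter; so a local rewriting that keeps the mass and does not lengthen
    the list cannot raise the contribution of the surrounding entries. *)
Lemma moment_cat s1 s2 :
  moment (s1 ++ s2) = moment s1 + sumn s1 * size s2 + moment s2.
Proof. by elim: s1 => //= a s1 ->; rewrite size_cat; lia. Qed.

Lemma height_cat s1 s2 : height (s1 ++ s2) = height s1 + height s2.
Proof. by rewrite /height map_cat sumn_cat. Qed.

Lemma moment_nseq1 n : (moment (nseq n 1)).*2 = n * n.-1.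
Proof. elim: n => //= n IH; rewrite size_nseq; nia. Qed.

Lemma height_nseq1 n : height (nseq n 1) = 0.
Proof. by rewrite /height map_nseq /= sumn_nseq mul0n. Qed.

(** * Effect of a move *)

Definition fib_entry (x : nat) : Prop := exists2 i, 0 < i & x = zfib i.

Lemma zmove_local_sumn u v : zmove_local u v -> sumn v = sumn u.
Proof.
case=> [i _|| [|[|[|i]]] // _ || i j _ _] //=; rewrite ?subSS ?subn0 ?zfibSS; lia.
Qed.

Lemma zmove_local_size u v : zmove_local u v -> size v <= size u.
Proof. by case. Qed.

Lemma zmove_local_fib u v :
  zmove_local u v -> forall x, x \in v -> fib_entry x.
Proof.
have F i : 0 < i -> fib_entry (zfib i) by exists i.
case=> [i i0|| i i2|| i j j0 ji] x; rewrite !inE;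
  do ?[case/orP]; move/eqP->; apply: F; lia.
Qed.

(** The factor 6 is the least integer for which merging 3, 5 into 8 works: the
    moment drops by 3 and the height rises by 16 - 5 = 11 <= 6 * (3 - 1).  Small
    indices are separated because the level is truncated there. *)
Lemma zmove_local_potential u v :
  zmove_local u v -> potential v + 6 <= potential u.
Proof.
rewrite /potential /height; case=> [i i_gt0 || i i_gt2 || i j j_gt0 ltji] //=;
  rewrite ?muln1 ?muln0 ?addn0.
- rewrite !level_zfib //.
  case: i i_gt0 => [|[|[|i]]] // _.
  have := zfib_gt0 i.+1; have := zfib_gt0 i; rewrite !subSS !subn0 !zfibSS; nia.
- have [i_gt0 i2_gt0] : 0 < i /\ 0 < i - 2 by lia.
  rewrite !level_zfib //.
  case: i i_gt2 {i_gt0 i2_gt0} => [|[|[|[|[|i]]]]] // _.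
  have := zfib_gt0 i.+1; have := zfib_gt0 i; rewrite !subSS !subn0 !zfibSS; nia.
- have i_gt0 : 0 < i by exact: leq_trans ltji.
  have := zfib_lt _ _ j_gt0 ltji; nia.
Qed.

Lemma zmove_sumn s t : zmove s t -> sumn t = sumn s.
Proof. by case=> s1 s2 u v /zmove_local_sumn; rewrite !sumn_cat => ->. Qed.

Lemma zmove_fib s t : zmove s t ->
  (forall x, x \in s -> fib_entry x) -> forall x, x \in t -> fib_entry x.
Proof.
case=> s1 s2 u v uv sF x; rewrite !mem_cat => /or3P[xs1 | xv | xs2].
- by apply: sF; rewrite mem_cat xs1.
- exact: zmove_local_fib uv x xv.
- by apply: sF; rewrite !mem_cat xs2 !orbT.
Qed.

Lemma zmove_potential s t : zmove s t -> potential t + 6 <= potential s.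
Proof.
case=> s1 s2 u v uv; have := zmove_local_potential _ _ uv.
rewrite /potential !moment_cat !height_cat !size_cat (zmove_local_sumn _ _ uv).
have := zmove_local_size _ _ uv; nia.
Qed.

(** * Plays *)

Lemma zplay_exists s : exists k, zplay s k.
Proof.
have [m] := ubnP (potential s); elim: m s => // m IH s ltsm.
have [sT | /existsNP[t /contrapT st]] := pselect (zterminal s).
  by exists 0; apply: ZEnd.
have [k tk] : exists k, zplay t k.
  by apply: IH; have := zmove_potential _ _ st; lia.
by exists k.+1; apply: ZStep st tk.
Qed.

(** Summing the drops of the potential along a play; the final height is kept
    because it is what the play wastes. *)
Lemma zplay_end s k : zplay s k -> (forall x, x \in s -> fib_entry x) ->
  exists t, [/\ zterminal t, forall x, x \in t -> fib_entry x,
    sumn t = sumn s & 6 * k + height t <= potential s].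
Proof.
elim=> {s k} [s sT sF | s t k st _ IH sF].
  by exists s; split=> //; rewrite /potential; lia.
have [r [rT rF rS rP]] := IH (zmove_fib _ _ st sF).
exists r; split=> //; first by rewrite rS (zmove_sumn _ _ st).
by have := zmove_potential _ _ st; lia.
Qed.

(** * Terminal states *)

Lemma zmove_local_descent i j : 0 < j -> j <= i ->
  exists v, zmove_local [:: zfib i; zfib j] v.
Proof.
move=> j_gt0; rewrite leq_eqVlt => /predU1P[<- {i} | ltji]; last first.
  by exists [:: zfib j; zfib i]; apply: ZSwitch.
case: j j_gt0 => [|[|[|j]]] // _.
- by exists [:: zfib 2]; apply: ZMergeOnes.
- by exists [:: zfib 1; zfib 3]; apply: ZSplitTwos.
- by eexists; apply: ZSplit.
Qed.

Lemma zterminal_sorted t : zterminal t ->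
  (forall x, x \in t -> fib_entry x) -> sorted ltn t.
Proof.
move=> tT tF; apply/(sortedP 0) => k ltk; apply: contrapT => /negP.
rewrite /= -leqNgt => lek.
have split_t : t = take k t ++ [:: nth 0 t k; nth 0 t k.+1] ++ drop k.+2 t.
  by rewrite /= -!drop_nth ?cat_take_drop // ltnW.
have [i i_gt0 iE] : fib_entry (nth 0 t k) by apply: tF; rewrite mem_nth // ltnW.
have [j j_gt0 jE] : fib_entry (nth 0 t k.+1) by apply: tF; rewrite mem_nth.
rewrite iE jE zfib_leE // in lek; rewrite iE jE in split_t.
have [v uv] := zmove_local_descent _ _ j_gt0 lek.
by apply: (tT (take k t ++ v ++ drop k.+2 t)); rewrite {1}split_t; apply: ZMove.
Qed.

(** Distinct Fibonacci numbers up to F_m sum to at most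
    F_1 + ... + F_m = F_(m+2) - 2. *)
Lemma sumn_sorted_fib s m : 0 < m -> sorted ltn (rcons s (zfib m)) ->
  (forall x, x \in s -> fib_entry x) -> sumn (rcons s (zfib m)) <= zfib m.+2.
Proof.
elim/last_ind: s m => [|s x IH] m m_gt0.
  by rewrite /= addn0 zfibSS -{1}(addn0 (zfib m)) leq_add // zfib_le.
move=> sm sF; have [i i_gt0 xE] : fib_entry x by apply: sF; rewrite mem_rcons mem_head.
rewrite {x}xE in sm sF *.
have [si ltim] : sorted ltn (rcons s (zfib i)) /\ i < m.
  move: sm; rewrite -!cats1 -catA /= => sm; split.
    by move: sm; rewrite (catA s [:: _] [:: _]) => /cat_sorted2[].
  have /cat_sorted2[_ /=] := sm.
  by rewrite andbT ltnNge zfib_leE // -ltnNge.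
rewrite sumn_rcons (zfibSS m) leq_add2r.
apply: leq_trans (IH _ i_gt0 si _) _; last by rewrite zfib_le.
by move=> x xs; apply: sF; rewrite mem_rcons inE xs orbT.
Qed.

Lemma zfibSS_le3 m : 0 < m -> zfib m.+2 <= 3 * zfib m.
Proof.
case: m => // m _; have := zfib_gt0 m; rewrite !zfibSS.
have : zfib m <= zfib m.+1 by case: m => // m; apply: zfib_le.
lia.
Qed.

(** The last entry alone already carries a third of the mass, and all of that
    third sits at the top level. *)
Lemma height_sorted_fib t : 0 < sumn t -> sorted ltn t ->
    (forall x, x \in t -> fib_entry x) ->
  exists2 m, sumn t <= zfib m.+2 & sumn t * (m - 3) <= 3 * height t.
Proof.
case/lastP: t => // s x _ ts tF.
have [m m_gt0 xE] : fib_entry x by apply: tF; rewrite mem_rcons mem_head.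
rewrite {x}xE in ts tF *; have le_sum : sumn (rcons s (zfib m)) <= zfib m.+2.
  apply: sumn_sorted_fib => // x xs; apply: tF.
  by rewrite mem_rcons inE xs orbT.
exists m => //; have := zfibSS_le3 _ m_gt0.
have : zfib m * (m - 3) <= height (rcons s (zfib m)).
  by rewrite -cats1 height_cat {2}/height /= level_zfib // addn0 leq_addl.
move: (height _) => h; nia.
Qed.

(** Combines the initial potential 3 n (n - 1) with the final height, scaled by
    3 to clear the denominator. *)
Lemma zplay_length n k : 0 < n -> zplay (zinit n) k ->
  exists2 m, n <= zfib m.+2 & 18 * k + n * (m - 3) <= 9 * (n * n.-1).
Proof.
move=> n_gt0 /zplay_end[x|t [tT tF tS tP]].
  by move=> /nseqP[-> _]; exists 1.
have {}tS : sumn t = n by rewrite tS sumn_nseq mul1n.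
have [|m n_le hm] := height_sorted_fib t _ (zterminal_sorted _ tT tF) tF.
  by rewrite tS.
rewrite tS in n_le hm; exists m => //.
rewrite /potential /zinit -[zfib 1]/1 height_nseq1 in tP; rewrite -moment_nseq1; lia.
Qed.

Lemma max_play_length_exists n : exists m, is_max_play_length n m.
Proof.
have [k0 k0P] := zplay_exists (zinit n).
have exP : exists k, `[< zplay (zinit n) k >] by exists k0; apply/asboolP.
have ubP k : `[< zplay (zinit n) k >] -> k <= potential (zinit n).
  move=> /asboolP/zplay_end[x|t [_ _ _ tP]]; last by lia.
  by move=> /nseqP[-> _]; exists 1.
have [m /asboolP mP mmax] := ex_maxnP exP ubP.
by exists m; split=> // k kP; apply: mmax; apply/asboolP.
Qed.

(** * Comparison with the golden ratio *)

Local Open Scope ring_scope.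

Section Golden.
Context {R : realType}.
Local Notation phi := (golden : R).

Lemma golden_sqr : phi ^+ 2 = phi + 1.
Proof.
have := @sqr_sqrtr R 5 (ler0n _ _); rewrite /golden; move: (Num.sqrt 5) => s s2.
rewrite expr_div_n sqrrD s2; lra.
Qed.

Lemma golden_gt1 : 1 < phi.
Proof.
have : (1 : R) < Num.sqrt 5 by rewrite -[ltLHS]sqrtr1 ltr_sqrt ?(ltr0n, ltr1n).
rewrite /golden; lra.
Qed.

Lemma zfib_le_golden i : (zfib i)%:R <= phi ^+ i.
Proof.
elim/ltn_ind: i => -[|[|i]] IH; first by rewrite expr0.
  by rewrite expr1 ltW ?golden_gt1.
rewrite zfibSS natrD -addn2 exprD golden_sqr mulrDr mulr1 -exprSr.
by rewrite lerD // IH.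
Qed.

Lemma log_golden_le m n : (0 < n)%N -> (n <= zfib m)%N ->
  log_golden n%:R <= m%:R :> R.
Proof.
move=> n_gt0 le_n; rewrite /log_golden ler_pdivrMr ?ln_gt0 ?golden_gt1 //.
have phi_gt0 : 0 < phi by rewrite (lt_trans ltr01) ?golden_gt1.
rewrite mulr_natl -lnXn // ler_ln ?posrE ?exprn_gt0 ?ltr0n //.
by apply: le_trans (zfib_le_golden _); rewrite ler_nat.
Qed.

Lemma cvg_ln_pinfty : ln x @[x --> +oo] --> (+oo : set_system R).
Proof.
apply/cvgryPge => A; near=> x.
have x_gt0 : 0 < x by near: x; apply: nbhs_pinfty_gt; rewrite num_real.
by rewrite -[A]expRK ler_ln ?posrE ?expR_gt0.
Unshelve. all: by end_near. Qed.

Lemma cvg_log_golden_pinfty : log_golden (n%:R : R) @[n --> \oo] --> +oo.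
Proof.
have lnV_gt0 : 0 < (ln phi)^-1 by rewrite invr_gt0 ln_gt0 ?golden_gt1.
exact: (cvg_comp _ _ cvgr_idn (gt0_cvgMly lnV_gt0 cvg_ln_pinfty)).
Qed.

End Golden.

(** * The bound on the maximal length *)

Theorem theorem1p11 (R : realType) :
  exists M : nat -> nat,
    (forall n : nat, is_max_play_length n (M n)) /\
    exists e : nat -> R,
      (fun n : nat => e n / (n%:R * log_golden n%:R)) @ \oo --> (0 : R) /\
      forall n : nat, (2 <= n)%N ->
        (M n)%:R <= n%:R ^+ 2 / 2 - 1 / 32 * (n%:R * log_golden n%:R) + e n.
Proof.
have [M MP] := choice max_play_length_exists.
exists M; split=> //; exists (fun n => n%:R); split.
  have : (fun n => (log_golden (n%:R : R))^-1) @ \oo --> (0 : R).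
    apply/gtr0_cvgV0; last exact: cvg_log_golden_pinfty.
    near=> n; rewrite divr_gt0 ?ln_gt0 ?golden_gt1 // ltr1n.
    by near: n; exact: nbhs_infty_gt.
  apply: cvg_trans; apply: near_eq_cvg; near=> n.
  rewrite /= [in RHS]invfM [RHS]mulrA mulfV ?mul1r // pnatr_eq0 -lt0n.
  by near: n; exact: nbhs_infty_gt.
move=> n n_ge2; have n_gt0 : (0 < n)%N by exact: ltnW.
have [m n_le kP] := zplay_length _ _ n_gt0 (proj1 (MP n)).
have log_le := log_golden_le (R := R) _ _ n_gt0 n_le.
have log_ge0 : 0 <= log_golden (n%:R : R).
  by rewrite divr_ge0 ?ln_ge0 ?ler1n // ltW ?golden_gt1.
have {}kP : 18 * (M n)%:R + n%:R * (m%:R - 3) <= 9 * (n%:R * (n%:R - 1)) :> R.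
  have n1E : n%:R - 1 = n.-1%:R :> R by rewrite -{1}(prednK n_gt0) -natr1 addrK.
  have m3_le : m%:R - 3 <= (m - 3)%:R :> R.
    by rewrite lerBlDr -natrD ler_nat; lia.
  apply: (@le_trans _ _ ((18 * M n + n * (m - 3))%:R)).
    by rewrite natrD !natrM lerD2l ler_wpM2l.
  by rewrite n1E -!natrM ler_nat.
have n_pos : 0 < n%:R :> R by rewrite ltr0n.
(* With L = log n <= m + 2, the bound is n^2/2 - n/2 - n (L - 5) / 18, and
   5/18 - 1/2 <= 1 while 1/18 >= 1/32. *)
nra.
Unshelve. all: by end_near. Qed.
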